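(* Let $d\ge2$. For every $\gamma,\lambda>0$, the random collection $\mathcal{D}_{\gamma,\lambda}$ coincides almost surely with the dual Poisson--Laguerre tessellation generated by $\widetilde\eta_{\gamma,\lambda}$; that is, $$\mathcal{D}_{\gamma,\lambda}=\mathcal{L}^*(\widetilde\eta_{\gamma,\lambda})\qquad\text{almost surely},$$ where $\widetilde\eta_{\gamma,\lambda}$ is a Poisson point process with intensity measure $\Lambda_{\gamma,\lambda}$ given by $$d\Lambda_{\gamma,\lambda}(v,h)=\frac{\gamma}{2}\,h^{-(d+1)/2}\,\mathbf 1\{h\ge\lambda^2\}\,dv\,dh .$$
   Context: $\mathbb{H}^d$ is hyperbolic space in the upper halfspace model $\mathbb{R}^{d-1}\times(0,\infty)$ with points $(v,y)$ and volume measure $\mathrm{vol}_{\mathbb{H}^d}(A)=\int_A y^{-d}\,dv\,dy$. Let $\eta_\gamma$ be a Poisson point process on $\mathbb{H}^d$ with intensity measure $\gamma\,\mathrm{vol}_{\mathbb{H}^d}$ and let $\eta_{\gamma,\lambda}:=\eta_\gamma\cap\{(v,y):y\ge\lambda\}$. For points $(v_1,y_1),\dots,(v_d,y_d)$ with $v_1,\dots,v_d$ affinely independent, $B(v_1,y_1,\dots,v_d,y_d)$ is the unique closed half-ball $\{(v,y)\in\mathbb{R}^{d-1}\times(0,\infty):\|v-w\|^2+y^2\le r^2\}$, with $w\in\mathbb{R}^{d-1}$ and $r>0$, whose bounding hemisphere contains all these points. $\mathcal{D}_{\gamma,\lambda}$ is the collection of all simplices $[v_1,\dots,v_d]$ (Euclidean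 convex hull in $\mathbb{R}^{d-1}$) such that $(v_1,y_1),\dots,(v_d,y_d)$ are pairwise distinct points of $\eta_{\gamma,\lambda}$, $v_1,\dots,v_d$ are affinely independent, and $\operatorname{int}B(v_1,y_1,\dots,v_d,y_d)\cap\eta_{\gamma,\lambda}=\varnothing$. For a locally finite $\zeta\subset\mathbb{R}^{d-1}\times\mathbb{R}$ and points $z_i=(v_i,h_i)$, $i=1,\dots,d$, with $v_1,\dots,v_d$ affinely independent, $\Pi(z_1,\dots,z_d)$ is the unique downward paraboloid $\{(v,h)\in\mathbb{R}^{d-1}\times\mathbb{R}:h\le s-\|v-w\|^2\}$ ($w\in\mathbb{R}^{d-1}$, $s\in\mathbb{R}$) whose boundary contains $z_1,\dots,z_d$. The dual Laguerre tessellation generated by $\zeta$ is $$\mathcal{L}^*(\zeta):=\{[v_1,\dots,v_d]:\ z_i=(v_i,h_i)\in\zeta,\ v_1,\dots,v_d\text{ affinely independent},\ \operatorname{int}\Pi(z_1,\dots,z_d)\cap\zeta=\varnothing\};$$ it is called dual Poisson--Laguerre tessellation when $\zeta$ is a Poisson process for which this collection is a locally finite simplicial random tessellation of $\mathbb{R}^{d-1}$. Finally, $\widetilde\eta_{\gamma,\lambda}:=T(\eta_{\gamma,\lambda})$ with $T(v,y):=(v,y^2)$ on $\mathbb{R}^{d-1}\times(0,\infty)$. *)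

(* Defs.v *)
From HB Require Import structures.
From mathcomp Require Import all_boot all_order all_algebra.
From mathcomp Require Import all_classical all_reals all_analysis.
From mathcomp Require Import measurable_realfun.
From mathcomp Require Import ring lra.

Set Implicit Arguments.
Unset Strict Implicit.
Unset Printing Implicit Defensive.

Import Order.TTheory GRing.Theory Num.Theory.
Import numFieldNormedType.Exports.

Local Open Scope classical_set_scope.
Local Open Scope ring_scope.

Definition measure_rV_display : measure_display -> measure_display.
Proof. exact. Qed.

(* The Borel structure of R^n: the sigma-algebra generated by the coordinates,
   as the library does for tuples. *)
Section measurable_rV.
Context {d} {T : measurableType d} (n : nat).

Let coord : 'I_n -> 'rV[T]_n -> T := fun i v => v ord0 i.

Let rV_set0 : g_sigma_preimage coord set0.
Proof. exact: sigma_algebra0. Qed.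

Let rV_setC A : g_sigma_preimage coord A -> g_sigma_preimage coord (~` A).
Proof. exact: sigma_algebraC. Qed.

Let rV_bigcup (F : (set 'rV[T]_n)^nat) :
  (forall i, g_sigma_preimage coord (F i)) ->
  g_sigma_preimage coord (\bigcup_i F i).
Proof. exact: sigma_algebra_bigcup. Qed.

HB.instance Definition _ := @isMeasurable.Build (measure_rV_display d)
  'rV[T]_n (g_sigma_preimage coord) rV_set0 rV_setC rV_bigcup.

End measurable_rV.

Section measurable_rV_fun.
Context d (T : measurableType d).

Lemma measurable_rV_coord n (i : 'I_n) :
  measurable_fun [set: 'rV[T]_n] (fun v : 'rV[T]_n => v ord0 i).
Proof.
move=> _ Y mY; rewrite setTI; apply: sub_sigma_algebra => /=.
rewrite -bigcup_seq/=; exists i => /=; first by rewrite mem_index_enum.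
by exists Y => //; rewrite setTI.
Qed.

Lemma measurable_fun_rVP d1 (T1 : measurableType d1) n (f : T1 -> 'rV[T]_n) :
  (forall i, measurable_fun [set: T1] (fun x => f x ord0 i)) ->
  measurable_fun [set: T1] f.
Proof.
move=> mf.
have pre : g_sigma_preimage (fun i x => f x ord0 i) `<=` @measurable _ T1.
  apply: smallest_sub; first exact: sigma_algebra_measurable.
  rewrite -bigcup_seq/=; apply: bigcup_sub => i _ A [B mB <-].
  exact: mf.
move=> _ A mA; apply: pre.
rewrite (g_sigma_preimage_comp (fun i (v : 'rV[T]_n) => v ord0 i) f).
by exists A.
Qed.

End measurable_rV_fun.

Definition rV_cons (T : Type) n (p : T * 'rV[T]_n) : 'rV[T]_n.+1 :=
  \row_i (if unlift ord0 i is Some j then p.2 ord0 j else p.1).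

Section lebesgue_rV.
Variable R : realType.

Lemma measurable_rV_cons n :
  measurable_fun [set: R * 'rV[R]_n] (@rV_cons R n).
Proof.
apply: measurable_fun_rVP => i.
have [j ->|->] := unliftP ord0 i.
  apply: (eq_measurable_fun (fun x : R * 'rV[R]_n => x.2 ord0 j)).
    by move=> x _; rewrite mxE liftK.
  exact: (measurableT_comp (measurable_rV_coord j) measurable_snd).
apply: (eq_measurable_fun (fun x : R * 'rV[R]_n => x.1)).
  by move=> x _; rewrite mxE unlift_none.
exact: measurable_fst.
Qed.

Let rV_uncons n (v : 'rV[R]_n.+1) : R * 'rV[R]_n :=
  (v ord0 ord0, \row_j v ord0 (lift ord0 j)).

Let measurable_rV_uncons n : measurable_fun [set: 'rV[R]_n.+1] (@rV_uncons n).
Proof.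
apply/measurable_fun_pairP; split; first exact: measurable_rV_coord.
apply: measurable_fun_rVP => j.
apply: (eq_measurable_fun (fun v : 'rV[R]_n.+1 => v ord0 (lift ord0 j))).
  by move=> x _ /=; rewrite mxE.
exact: measurable_rV_coord.
Qed.

Let rV_consK n : cancel (@rV_cons R n) (@rV_uncons n).
Proof.
move=> [x v]; rewrite /rV_uncons mxE unlift_none; congr pair.
by apply/rowP => j; rewrite !mxE liftK.
Qed.

Section step.
Variables (n : nat) (m : {sigma_finite_measure set 'rV[R]_n -> \bar R}).

(* The image of lebesgue_measure \x m under R x R^n = R^(n+1). *)
Definition lebesgue_step : set 'rV[R]_n.+1 -> \bar R :=
  pushforward (@lebesgue_measure R \x m)%E (@rV_cons R n).

Let push : {measure set 'rV[R]_n.+1 -> \bar R} :=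
  measure_function_pushforward__canonical__measure_function_Measure
    (@lebesgue_measure R \x m)%E (@measurable_rV_cons n).

HB.instance Definition _ := isMeasure.Build _ _ _ lebesgue_step
  (@measure0 _ _ _ push) (@measure_ge0 _ _ _ push)
  (@measure_semi_sigma_additive _ _ _ push).

Let lebesgue_step_sigma_finite : sigma_finite setT lebesgue_step.
Proof.
have /sigma_finiteP[F [FT Fnd Foo]] := sigma_finiteT (@lebesgue_measure R).
have /sigma_finiteP[G [GT Gnd Goo]] := sigma_finiteT m.
exists (fun k => @rV_uncons n @^-1` (F k `*` G k)) => [|k].
  rewrite -preimage_bigcup (_ : \bigcup_k _ = setT) ?preimage_setT//.
  rewrite -setXTT GT FT; apply/seteqP; split => -[x v].
    by move=> [k _ [? ?]]; split; exists k.
  move=> [[k _ Fx] [l _ Gv]]; exists (maxn k l) => //; split.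
    by move: (x) Fx; exact/subsetPset/Fnd/leq_maxl.
  by move: (v) Gv; exact/subsetPset/Gnd/leq_maxr.
have [mF Fk] := Foo k; have [mG Gk] := Goo k; split.
  rewrite -[X in measurable X]setTI; apply: measurable_rV_uncons => //.
  exact: measurableX.
rewrite /lebesgue_step /pushforward -comp_preimage.
rewrite (_ : _ \o _ = id); last by apply/funext => x /=; exact: rV_consK.
by rewrite preimage_id product_measure1E// lte_mul_pinfty// ge0_fin_numE.
Qed.

HB.instance Definition _ := @Measure_isSigmaFinite.Build _ _ _ lebesgue_step
  lebesgue_step_sigma_finite.

End step.

Fixpoint lebesgue_rV (n : nat) : {sigma_finite_measure set 'rV[R]_n -> \bar R} :=
  match n return {sigma_finite_measure set 'rV[R]_n -> \bar R} with
  | 0 => [the {sigma_finite_measure set 'rV[R]_0 -> \bar R} of \d_(0 : 'rV[R]_0)]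
  | n'.+1 => [the {sigma_finite_measure set 'rV[R]_n'.+1 -> \bar R} of
               lebesgue_step (lebesgue_rV n')]
  end.

Lemma lebesgue_rV_box n (A : 'I_n -> set R) : (forall i, measurable (A i)) ->
  lebesgue_rV n [set v | forall i, A i (v ord0 i)] =
  (\prod_(i < n) lebesgue_measure (A i))%E.
Proof.
elim: n A => [|n IH] A mA /=.
  by rewrite big_ord0 diracE mem_set//; case.
have mB : measurable [set v : 'rV[R]_n | forall i, A (lift ord0 i) (v ord0 i)].
  rewrite (_ : mkset _ = \bigcap_(i in [set: 'I_n])
     ((fun v : 'rV[R]_n => v ord0 i) @^-1` A (lift ord0 i))); last first.
    by apply/seteqP; split => v /= Av i => [_|]; exact: Av.
  apply: fin_bigcap_measurable => // i _.
  by rewrite -[X in measurable X]setTI; exact: measurable_rV_coord.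
rewrite big_ord_recl -IH; last by move=> i; exact: mA.
rewrite /lebesgue_step /pushforward -product_measure1E//; last exact: mA.
congr (_ _); apply/seteqP; split => -[x v] /=.
  move=> Av; split; first by have := Av ord0; rewrite mxE unlift_none.
  by move=> i; have := Av (lift ord0 i); rewrite mxE liftK.
move=> [Ax Av] i; rewrite mxE /=.
by have [j ->|->] := unliftP ord0 i; [exact: Av|exact: Ax].
Qed.

End lebesgue_rV.

(* The library norm on 'rV[R]_n is the sup norm, hence the explicit squared
   Euclidean norm; both norms induce the same topology. *)

Section euclidean.
Variable R : realType.

Definition sqnorm n (v : 'rV[R]_n) : R := \sum_(i < n) v ord0 i ^+ 2.

Definition affinely_independent (I : finType) n (v : I -> 'rV[R]_n) : Prop :=
  forall a : I -> R, \sum_i a i = 0 -> \sum_i a i *: v i = 0 ->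
    forall i, a i = 0.

Definition simplex (I : finType) n (v : I -> 'rV[R]_n) : set 'rV[R]_n :=
  [set x | exists a : I -> R,
    [/\ forall i, 0 <= a i, \sum_i a i = 1 & x = \sum_i a i *: v i]].

End euclidean.

(* Hyperbolic space H^d is the subset upper_half of R^(d-1) x R. *)

Section tessellations.
Variables (R : realType) (d : nat).
Local Notation point := ('rV[R]_d.-1 * R)%type.

Definition upper_half : set point := [set z | 0 < z.2].

Definition half_ball (w : 'rV[R]_d.-1) (r : R) : set point :=
  [set z | 0 < z.2 /\ sqnorm (z.1 - w) + z.2 ^+ 2 <= r ^+ 2].

Definition hemisphere (w : 'rV[R]_d.-1) (r : R) : set point :=
  [set z | 0 < z.2 /\ sqnorm (z.1 - w) + z.2 ^+ 2 = r ^+ 2].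

Definition is_half_ball_through (z : 'I_d -> point) (B : set point) : Prop :=
  exists w r, [/\ 0 < r, B = half_ball w r & forall i, hemisphere w r (z i)].

(* Existence and uniqueness: half_ball_throughP below. *)
Definition half_ball_through (z : 'I_d -> point) : set point :=
  xget set0 (is_half_ball_through z).

Definition paraboloid (w : 'rV[R]_d.-1) (s : R) : set point :=
  [set z | z.2 <= s - sqnorm (z.1 - w)].

Definition paraboloid_boundary (w : 'rV[R]_d.-1) (s : R) : set point :=
  [set z | z.2 = s - sqnorm (z.1 - w)].

Definition is_paraboloid_through (z : 'I_d -> point) (Q : set point) : Prop :=
  exists w s, Q = paraboloid w s /\ forall i, paraboloid_boundary w s (z i).

(* Existence and uniqueness: paraboloid_throughP below. *)
Definition paraboloid_through (z : 'I_d -> point) : set point :=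
  xget set0 (is_paraboloid_through z).

Definition hyp_delaunay (xi : set point) : set (set 'rV[R]_d.-1) :=
  [set S | exists z : 'I_d -> point,
    [/\ forall i, xi (z i), injective z,
        affinely_independent (fun i => (z i).1),
        (half_ball_through z)° `&` xi = set0 &
        S = simplex (fun i => (z i).1)]].

Definition dual_laguerre (zeta : set point) : set (set 'rV[R]_d.-1) :=
  [set S | exists z : 'I_d -> point,
    [/\ forall i, zeta (z i),
        affinely_independent (fun i => (z i).1),
        (paraboloid_through z)° `&` zeta = set0 &
        S = simplex (fun i => (z i).1)]].

Definition truncate_height (lambda : R) (xi : set point) : set point :=
  xi `&` [set z | lambda <= z.2].

Definition square_height (z : point) : point := (z.1, z.2 ^+ 2).

End tessellations.

Section well_defined.
Variable R : realType.

Let sqnormB n (v w : 'rV[R]_n) :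
  sqnorm (v - w) = sqnorm v - 2 * (v *m w^T) ord0 ord0 + sqnorm w.
Proof.
rewrite /sqnorm mxE mulr_sumr -sumrB -big_split /=; apply: eq_bigr => i _.
by rewrite !mxE sqrrB mulrA [2 * _]mulrC -mulr_natl; congr (_ - _ + _); ring.
Qed.

(* d affinely independent points of R^(d-1) with prescribed heights: the
   equations |v_i - w|^2 + g_i = s are linear in (2 w, s - |w|^2). *)
Lemma lifted_sphereP n (v : 'I_n.+1 -> 'rV[R]_n) (g : 'I_n.+1 -> R) :
  affinely_independent v ->
  exists! ws : 'rV[R]_n * R, forall i, sqnorm (v i - ws.1) + g i = ws.2.
Proof.
move=> vi.
pose M : 'M[R]_(n.+1, 1 + n) := row_mx (const_mx 1) (\matrix_i v i).
have uM : (M : 'M[R]_n.+1) \in unitmx.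
  rewrite -row_free_unit -kermx_eq0; apply/eqP/row_matrixP => k.
  set a := row k _; rewrite row0.
  have aM : a *m M = 0 by apply/sub_kermxP; exact: row_sub.
  clearbody a; move: aM.
  rewrite mul_mx_row -[RHS](@row_mx0 _ 1 1 n) => /eq_row_mx[a1 av].
  apply/rowP => i; rewrite [RHS]mxE; apply: (vi (fun i => a ord0 i)).
    have := congr1 (fun A : 'M[R]_1 => A ord0 ord0) a1; rewrite !mxE => a1E; rewrite -[RHS]a1E.
    by apply: eq_bigr => j _; rewrite [const_mx 1 _ _]mxE mulr1.
  rewrite -[RHS]av mulmx_sum_row; apply: eq_bigr => j _.
  by congr (_ *: _); apply/rowP => l; rewrite !mxE.
pose g' : 'cV[R]_n.+1 := \col_i (sqnorm (v i) + g i).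
pose U (ws : 'rV[R]_n * R) : 'cV[R]_(1 + n) :=
  col_mx (ws.2 - sqnorm ws.1)%:M (2 *: ws.1^T).
have UE ws : (forall i, sqnorm (v i - ws.1) + g i = ws.2) <-> M *m U ws = g'.
  have MU i : (M *m U ws) i ord0 =
      ws.2 - sqnorm ws.1 + 2 * (v i *m ws.1^T) ord0 ord0.
    rewrite mul_row_col mxE; congr (_ + _).
      by rewrite mxE big_ord1 !mxE mul1r mulr1n.
    rewrite -scalemxAr mxE; congr (_ * _).
    by rewrite !mxE; apply: eq_bigr => j _; rewrite !mxE.
  split=> [h|h i].
    apply/colP => i; rewrite (MU i) [RHS]mxE -(h i) sqnormB; ring.
  have := congr1 (fun A : 'cV[R]_n.+1 => A i ord0) h.
  by rewrite /= (MU i) [RHS]mxE sqnormB => h'; lra.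
pose u : 'cV[R]_(1 + n) := invmx (M : 'M[R]_n.+1) *m g'.
pose w : 'rV[R]_n := 2^-1 *: (dsubmx u)^T.
exists (w, usubmx u ord0 ord0 + sqnorm w); split.
  apply/UE; rewrite (_ : U _ = u); first by rewrite mulKVmx.
  rewrite /U /= addrK -[RHS]vsubmxK; congr col_mx.
    by apply/colP => i; rewrite !ord1 mxE mulr1n.
  by rewrite /w linearZ /= trmxK scalerA divff ?pnatr_eq0// scale1r.
move=> ws /UE Uws.
have uU : u = U ws by rewrite /u -Uws mulKmx.
have wE : w = ws.1.
  rewrite /w uU col_mxKd linearZ /= trmxK scalerA mulVf ?pnatr_eq0//.
  by rewrite scale1r.
by rewrite wE uU col_mxKu mxE mulr1n subrK -surjective_pairing.
Qed.

Lemma half_ball_throughP d (z : 'I_d -> 'rV[R]_d.-1 * R) : (0 < d)%N ->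
  (forall i, upper_half (z i)) -> affinely_independent (fun i => (z i).1) ->
  exists! B, is_half_ball_through z B.
Proof.
case: d z => // n z _ z0 zi.
have [[w s] [/= ws uniq_ws]] := lifted_sphereP (fun i => (z i).2 ^+ 2) zi.
have s0 : 0 < s.
  rewrite -(ws ord0) ltr_wpDl ?exprn_gt0//; last exact: z0.
  by apply: sumr_ge0 => i _; exact: sqr_ge0.
exists (@half_ball R n.+1 w (Num.sqrt s)); split.
  exists w, (Num.sqrt s); split=> [|//|i]; first by rewrite sqrtr_gt0.
  by split; [exact: z0|rewrite sqr_sqrtr ?ws// ltW].
move=> B [w' [r [r0 -> wr]]].
have /uniq_ws[-> ->] : forall i,
  sqnorm ((z i).1 - (w', r ^+ 2).1) + (z i).2 ^+ 2 = (w', r ^+ 2).2.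
  by move=> i; have [_] := wr i.
by rewrite sqrtr_sqr gtr0_norm.
Qed.

Lemma paraboloid_throughP d (z : 'I_d -> 'rV[R]_d.-1 * R) : (0 < d)%N ->
  affinely_independent (fun i => (z i).1) ->
  exists! Q, is_paraboloid_through z Q.
Proof.
case: d z => // n z _ zi.
have [[w s] [/= ws uniq_ws]] := lifted_sphereP (fun i => (z i).2) zi.
exists (@paraboloid R n.+1 w s); split.
  by exists w, s; split=> // i; rewrite /paraboloid_boundary /= -(ws i); ring.
move=> Q [w' [s' [-> ws']]].
have /uniq_ws[-> ->//] : forall i,
  sqnorm ((z i).1 - (w', s').1) + (z i).2 = (w', s').2.
by move=> i; rewrite (ws' i) /=; ring.
Qed.

End well_defined.

(* Point processes are simple: a point process on E is a random locally finite
   subset of E, and the number of its points in B is a cardinal. *)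

Section poisson_process.
Context {R : realType} {dO : measure_display} {O : measurableType dO}.
Variable P : probability O R.

Definition independent_variables m (X : 'I_m -> O -> \bar R) : Prop :=
  forall E : 'I_m -> set (\bar R), (forall i, measurable (E i)) ->
    P (\bigcap_(i in [set: 'I_m]) (X i @^-1` E i)) =
    (\prod_(i < m) P (X i @^-1` E i))%E.

(* Poisson law with parameter m in [0, +oo]; parameter +oo means the constant
   +oo. The second argument of poisson_prob is a dummy. *)
Definition poisson_variable (N : O -> \bar R) (m : \bar R) : Prop :=
  measurable_fun setT N /\
  match m with
  | r%:E => 0 <= r /\
      forall k : nat, P (N @^-1` [set k%:R%:E]) = poisson_prob r 0%N [set k]
  | +oo%E => P (N @^-1` [set +oo%E]) = 1%E
  | -oo%E => False
  end.

Context {n : nat}.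
Local Notation point := ('rV[R]_n * R)%type.

Definition point_count (eta : O -> set point) (B : set point) : O -> \bar R :=
  fun w => counting (eta w `&` B).

Definition poisson_process (E : set point) (mu : set point -> \bar R)
    (eta : O -> set point) : Prop :=
  [/\ forall w, eta w `<=` E,
      forall w (K : set point), compact K -> K `<=` E ->
        finite_set (eta w `&` K),
      forall B : set point, measurable B ->
        poisson_variable (point_count eta B) (mu B) &
      forall m (B : 'I_m -> set point), (forall i, measurable (B i)) ->
        trivIset setT B ->
        independent_variables (fun i => point_count eta (B i))].

End poisson_process.

Section intensities.
Variables (R : realType) (d : nat).
Local Notation point := ('rV[R]_d.-1 * R)%type.

Definition hyp_volume (A : set point) : \bar R :=
  (\int[lebesgue_rV R d.-1 \x @lebesgue_measure R]_(z in A `&` @upper_half R d)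
     (z.2 ^- d)%:E)%E.

Definition laguerre_intensity (gamma lambda : R) (A : set point) : \bar R :=
  (\int[lebesgue_rV R d.-1 \x @lebesgue_measure R]_(z in A)
     (gamma / 2 * z.2 `^ (- (d.+1%:R / 2)) *
      \1_[set h : R | lambda ^+ 2 <= h] z.2)%:E)%E.

End intensities.

(* Main.v *)
Require Import Defs.
From HB Require Import structures.
From mathcomp Require Import all_boot all_order all_algebra.
From mathcomp Require Import all_classical all_reals all_analysis.
From mathcomp Require Import measurable_realfun.
From mathcomp Require Import ring.

Set Implicit Arguments.
Unset Strict Implicit.
Unset Printing Implicit Defensive.

Import Order.TTheory GRing.Theory Num.Theory.
Import numFieldNormedType.Exports.

Local Open Scope classical_set_scope.
Local Open Scope ring_scope.

(** The map T(v, y) = (v, y^2) turns hyperbolic geometry into the geometry of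
paraboloids: the half-ball condition |v - w|^2 + y^2 <= r^2 reads
h <= r^2 - |v - w|^2 for h = y^2, so T carries the half-ball with centre w and
radius r onto the part above height 0 of the paraboloid with apex (w, r^2).
Interiors correspond as well, both being given by the strict inequality
([interior_half_ball], [interior_paraboloid]), and the half-ball through
z_1, ..., z_d corresponds to the paraboloid through T z_1, ..., T z_d because
the latter is unique. Hence the empty half-ball condition for a set of points
of the half-space is the empty paraboloid condition for its image, and the two
collections of simplices agree for every realization, not only almost surely
([hyp_delaunay_square]).

That the image process is Poisson is the mapping theorem for an injective map:
the image process has as many points in B as the original process has in the
region T^-1 B above height lambda ([point_count_square]), so Poisson counts
and independence over disjoint sets are inherited. Two things remain. The mean
number of points has to be the stated one ([laguerre_intensity_lift]): by
Tonelli this is, for fixed v, the substitution h = y^2 with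
gamma/2 h^(-(d+1)/2) dh = gamma y^(-d) dy, which is needed on arbitrary Borel
sets of heights and so is extended from intervals by uniqueness of measures
([integral_sqr_substitution]). And the image process is locally finite in the
whole space, although the original one is locally finite only in the open
half-space: truncation at height lambda keeps the preimage of a compact set
inside a compact subset of the half-space ([lift_region_sub_compact]). *)

(** * Half-balls and paraboloids *)

Section geometry.
Variable R : realType.

Lemma continuous_sqnorm n (w : 'rV[R]_n) :
  continuous (fun v : 'rV[R]_n => sqnorm (v - w)).
Proof.
apply: continuous_big => [|i _ v]; first exact: add_continuous.
have cvi : {for v, continuous (fun u : 'rV[R]_n => u ord0 i - w ord0 i)}.
  apply: continuousB; last exact: cst_continuous.
  exact: (@coord_continuous R 1 n ord0 i v).
rewrite (_ : (fun u => _) = (fun u : 'rV[R]_n => (u ord0 i - w ord0 i) ^+ 2)).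
  exact: (continuous_comp cvi (@exprn_continuous R 2 _)).
by apply/funext => u; rewrite !mxE.
Qed.

(** The only consequence of interiority used below: a point whose height cannot
be increased within [A] is not interior to [A]. It excludes the bounding
hemisphere and the bounding paraboloid without any discussion of neighborhoods
in the horizontal directions. *)
Lemma interior_raise n (A : set ('rV[R]_n * R)) (z : 'rV[R]_n * R) :
  A° z -> exists2 e, 0 < e & A (z.1, z.2 + e).
Proof.
case: z => v h Az /=.
have ch : (fun e : R => h + e) @ (0 : R) --> h.
  rewrite -[X in _ --> X]addr0; apply: (@continuousD _ R R (cst h) id);
    [exact: cst_continuous|exact: cvg_id].
have cvh : (fun e : R => (v, h + e)) @ (0 : R) --> (v, h).
  exact: (cvg_pair (cvg_cst v) ch).
have /nbhs_ballP[e /= e0 /(_ (e / 2))] := cvh _ Az.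
rewrite -ball_normE /= sub0r normrN gtr0_norm ?divr_gt0// => Ae.
exists (e / 2); first by rewrite divr_gt0.
by apply: Ae; rewrite ltr_pdivrMr// ltr_pMr// ltr1n.
Qed.

Lemma interior_paraboloid d (w : 'rV[R]_d.-1) s :
  (paraboloid (d := d) w s)° = [set z | z.2 < s - sqnorm (z.1 - w)].
Proof.
apply/seteqP; split => [z /interior_raise[e e0]|].
  by rewrite /paraboloid /=; apply: lt_le_trans; rewrite ltrDl.
have op : open [set z : 'rV[R]_d.-1 * R | z.2 < s - sqnorm (z.1 - w)].
  rewrite (_ : mkset _ =
    (fun z : 'rV[R]_d.-1 * R => sqnorm (z.1 - w) + z.2) @^-1` [set x | x < s]).
    apply: open_comp; last exact: open_lt.
    move=> z _; apply: cvgD; last exact: cvg_snd.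
    exact: (continuous_comp cvg_fst (@continuous_sqnorm _ w _)).
  by apply/seteqP; split => z /=; rewrite ltrBrDl.
by rewrite -open_subsetE// => z /= /ltW.
Qed.

Lemma interior_half_ball d (w : 'rV[R]_d.-1) r :
  (half_ball (d := d) w r)° =
  [set z | 0 < z.2 /\ sqnorm (z.1 - w) + z.2 ^+ 2 < r ^+ 2].
Proof.
apply/seteqP; split => [z Bz|].
  have [z0 _] := interior_subset Bz; split => //.
  have [e e0 [_ /=]] := interior_raise Bz.
  by apply: lt_le_trans; rewrite ltrD2l ltrXn2r ?nnegrE ?ltW ?addr_gt0 ?ltrDl.
have op : open [set z : 'rV[R]_d.-1 * R |
    0 < z.2 /\ sqnorm (z.1 - w) + z.2 ^+ 2 < r ^+ 2].
  apply: openI.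
    apply: (@open_comp _ _ _ [set x : R | 0 < x]); last exact: open_gt.
    by move=> z _; exact: cvg_snd.
  apply: (@open_comp _ _
    (fun z : 'rV[R]_d.-1 * R => sqnorm (z.1 - w) + z.2 ^+ 2)
     [set x | x < r ^+ 2]); last exact: open_lt.
  move=> z _; apply: cvgD.
    exact: (continuous_comp cvg_fst (@continuous_sqnorm _ w _)).
  exact: (continuous_comp cvg_snd (@exprn_continuous R 2 _)).
by rewrite -open_subsetE// => z /= [z0 /ltW].
Qed.

(** Both bodies through the given points exist and are unique, so it suffices
to check that the paraboloid with apex (w, r^2) passes through the squared
points as soon as the hemisphere with centre w and radius r passes through the
original ones. *)
Lemma interior_half_ball_through d (z : 'I_d -> 'rV[R]_d.-1 * R) :
  (0 < d)%N -> (forall i, upper_half (z i)) ->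
  affinely_independent (fun i => (z i).1) ->
  forall x, upper_half x ->
    (half_ball_through z)° x <->
    (paraboloid_through (fun i => square_height (z i)))° (square_height x).
Proof.
move=> d0 z0 zi x x0.
have [B [BP _]] := half_ball_throughP d0 z0 zi.
have : is_half_ball_through z (half_ball_through z) by apply: xgetPex; exists B.
move=> [w [r [r0 -> wr]]].
have [Q [QP Quniq]] :=
  @paraboloid_throughP R d (fun i => square_height (z i)) d0 zi.
have -> : paraboloid_through (fun i => square_height (z i)) =
    paraboloid (d := d) w (r ^+ 2).
  transitivity Q; first by apply/esym/Quniq; apply: xgetPex; exists Q.
  apply: Quniq; exists w, (r ^+ 2); split => // i.
  rewrite /paraboloid_boundary /=; have [_ <-] := wr i.
  by rewrite addrAC subrr add0r.
rewrite interior_half_ball interior_paraboloid /= ltrBrDl.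
by split => [[]|].
Qed.

(** The simplices are compared vertex by vertex along the injective map T. When
going back from a paraboloid, the injectivity demanded of the vertices on the
hyperbolic side comes from their affine independence. *)
Lemma hyp_delaunay_square d (xi : set ('rV[R]_d.-1 * R)) : (0 < d)%N ->
  xi `<=` @upper_half R d ->
  hyp_delaunay xi = dual_laguerre (@square_height R d @` xi).
Proof.
move=> d0 xi0; apply/seteqP; split => [S [z [xiz _ zi Bz ->]]|].
  exists (fun i => square_height (z i)); split => //.
    by move=> i; exists (z i).
  apply/seteqP; split => // y [Py [x xix xy]]; rewrite -{}xy in Py.
  have : ((half_ball_through z)° `&` xi) x.
    split => //; apply/interior_half_ball_through => //; last exact: xi0.
    by move=> i; exact/xi0/xiz.
  by rewrite Bz.
move=> S [z' [xiz' zi Pz ->]].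
have [z zP] : {z : 'I_d -> 'rV[R]_d.-1 * R &
    forall i, xi (z i) /\ square_height (z i) = z' i}.
  apply: (@choice _ _ (fun i x => xi x /\ square_height x = z' i)) => i.
  by have [x ? ?] := xiz' i; exists x.
have z'E : z' = (fun i => square_height (z i)).
  by apply/funext => i; rewrite (zP i).2.
rewrite {}z'E in xiz' zi Pz *.
exists z; split => //.
- by move=> i; exact: (zP i).1.
- move=> i j zij; apply/eqP/negPn/negP => nij.
  (* if z i = z j, the coefficients 1 at i and -1 at j are an affine dependence
     of the vertices *)
  have sum1 k : \sum_l (l == k)%:R = 1 :> R.
    by rewrite (bigD1 k)//= eqxx big1 ?addr0// => l /negbTE ->.
  have sumv k : \sum_l (l == k)%:R *: (square_height (z l)).1 = (z k).1.
    rewrite (bigD1 k)//= eqxx scale1r big1 ?addr0// => l /negbTE ->.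
    by rewrite scale0r.
  have /(_ i) : forall k, ((k == i)%:R - (k == j)%:R : R) = 0.
    apply: zi; first by rewrite sumrB !sum1 subrr.
    under eq_bigr do rewrite scalerBl.
    by rewrite sumrB !sumv zij subrr.
  by rewrite eqxx (negbTE nij) subr0 => /eqP; rewrite oner_eq0.
- apply/seteqP; split => // x [Bx xix].
  have : ((paraboloid_through (fun i => square_height (z i)))° `&`
     (@square_height R d @` xi)) (square_height x).
    split; last by exists x.
    apply/interior_half_ball_through => //; last exact: xi0.
    by move=> i; exact/xi0/(zP i).1.
  by rewrite Pz.
Qed.

End geometry.

(** * The substitution h = y^2 on Borel sets of heights *)

Section substitution.
Variable R : realType.
Local Notation mu := (@lebesgue_measure R).

Lemma integral_sqr_substitution_itv (G : R -> R) (a b : R) :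
  0 < a -> a <= b -> (forall x, 0 < x -> {for x, continuous G}) ->
  (\int[mu]_(h in `[(a ^+ 2)%R, (b ^+ 2)%R]) (G h)%:E =
   \int[mu]_(y in `[a, b]) (G (y ^+ 2)%R * (2 * y)%R)%:E)%E.
Proof.
move=> a0 ab cG.
pose F : R -> R := fun y => y ^+ 2.
have dF : derive1 F = (fun y => 2 * y).
  apply/funext => y; rewrite /F derive1E.
  by rewrite exp_derive /= expr1 /GRing.scale /= mulr1 -mulr_natl.
have cF : continuous F by exact: exprn_continuous.
have cdF : continuous (derive1 F).
  rewrite dF => y; apply: (@continuousM R R (cst 2) id).
    exact: cst_continuous.
  exact: cvg_id.
transitivity (\int[mu]_(y in `[a, b]) (((G \o F) * derive1 F) y)%:E)%E;
  last first.
  by apply: eq_integral => y _; rewrite dF.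
rewrite -/(F a) -/(F b).
apply: (@integration_by_substitution_increasing R F G a b ab).
- move=> x y; rewrite !in_itv /= => /andP[ax _] /andP[ay _] xy.
  by rewrite /F ltrXn2r ?nnegrE// ltW// (lt_le_trans a0).
- by move=> x _; exact: cdF.
- by apply/cvg_ex; exists (derive1 F a); apply: cvg_at_right_filter; exact: cdF.
- by apply/cvg_ex; exists (derive1 F b); apply: cvg_at_left_filter; exact: cdF.
- split.
  + by move=> x _; exact: exprn_derivable.
  + by apply: cvg_at_right_filter; exact: cF.
  + by apply: cvg_at_left_filter; exact: cF.
- apply: continuous_in_subspaceT => x; rewrite inE /= in_itv /= => /andP[ax _].
  by apply: cG; rewrite (lt_le_trans _ ax)// exprn_gt0.
Qed.

Section sqr_substitution.
Variables (G : R -> R) (a : R).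
Hypotheses (a0 : 0 < a) (mG : measurable_fun setT G) (G0 : forall x, 0 <= G x)
  (cG : forall x, 0 < x -> {for x, continuous G}).

(** The two sides of the substitution rule, as functions of the set of heights
[A], are the measures [heights] (density with respect to dh) and [pushed] (the
image under squaring of the measure [roots] with density with respect to dy).
They agree on half-open intervals by the classical substitution rule, and they
are finite on bounded intervals, since the cut-off at [a > 0] keeps away from
the possible singularity of [G] at 0; hence they agree on Borel sets. *)
Let dens_h (h : R) : \bar R := (G h * \1_[set h | a ^+ 2 <= h] h)%:E.
Let dens_y (y : R) : \bar R :=
  (G (y ^+ 2) * (2 * y) * \1_[set y | a <= y] y)%:E.

Let ge_setE (c : R) : [set h | c <= h] = `[c, +oo[%classic.
Proof. by apply/seteqP; split => h /=; rewrite in_itv/= andbT. Qed.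

Let mge c : measurable [set h : R | c <= h].
Proof. by rewrite ge_setE; exact: measurable_itv. Qed.

Let dens_h_ge0 h : (0 <= dens_h h)%E.
Proof. by rewrite lee_fin mulr_ge0// indicE ler0n. Qed.

Let dens_y_ge0 y : (0 <= dens_y y)%E.
Proof.
rewrite lee_fin indicE; have [|_] := boolP (y \in _); last by rewrite mulr0.
by rewrite inE /= => ay; rewrite mulr1 !mulr_ge0// (le_trans (ltW a0)).
Qed.

Let mdens_h : measurable_fun setT dens_h.
Proof. by apply/measurable_EFinP; apply: measurable_funM. Qed.

Let msqr : measurable_fun setT (fun y : R => y ^+ 2).
Proof. exact: exprn_measurable. Qed.

Let mdens_y : measurable_fun setT dens_y.
Proof.
apply/measurable_EFinP; apply: measurable_funM; last exact: measurable_indic.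
apply: measurable_funM; first exact: (measurableT_comp mG msqr).
by apply: measurable_funM.
Qed.

Let heights (A : set (measurableTypeR R)) : \bar R :=
  (\int[mu]_(h in A) dens_h h)%E.

Let heights_set0 : heights set0 = 0. Proof. exact: integral_set0. Qed.
Let heights_ge0 A : (0 <= heights A)%E. Proof. exact: integral_ge0. Qed.
Let heights_sigma : semi_sigma_additive heights.
Proof. exact: semi_sigma_additive_nng_induced. Qed.
HB.instance Definition _ := isMeasure.Build _ _ _ heights
  heights_set0 heights_ge0 heights_sigma.

Let roots (A : set (measurableTypeR R)) : \bar R :=
  (\int[mu]_(y in A) dens_y y)%E.
Let roots_set0 : roots set0 = 0. Proof. exact: integral_set0. Qed.
Let roots_ge0 A : (0 <= roots A)%E. Proof. exact: integral_ge0. Qed.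
Let roots_sigma : semi_sigma_additive roots.
Proof. exact: semi_sigma_additive_nng_induced. Qed.
HB.instance Definition _ := isMeasure.Build _ _ _ roots
  roots_set0 roots_ge0 roots_sigma.

Let pushed (A : set (measurableTypeR R)) : \bar R :=
  pushforward roots (fun y : R => y ^+ 2) A.
Let push : {measure set (measurableTypeR R) -> \bar R} :=
  measure_function_pushforward__canonical__measure_function_Measure roots
    (msqr : measurable_fun setT
      (fun y : measurableTypeR R => (y ^+ 2 : measurableTypeR R))).
HB.instance Definition _ := isMeasure.Build _ _ _ pushed
  (@measure0 _ _ _ push) (@measure_ge0 _ _ _ push)
  (@measure_semi_sigma_additive _ _ _ push).

(** Cutting ]x, y] at [a ^+ 2] yields an interval that is closed on the left
exactly when the cut takes effect; the boolean [b] records which case occurs. *)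
Let itvE b x y : b = (x < a ^+ 2) ->
  `]x, y] `&` [set h | a ^+ 2 <= h] =
  [set` Interval (BSide b (Num.max x (a ^+ 2))) (BRight y)].
Proof.
move=> ->; apply/seteqP; split => h /=; rewrite !in_itv /=.
  move=> [/andP[xh hy] ah]; rewrite hy andbT.
  by case: (ltP x (a ^+ 2)).
by case: (ltP x (a ^+ 2)) => [xa|ax] /= /andP[xh ->]; rewrite andbT; split;
  rewrite ?(lt_le_trans xa)// ltW// (le_lt_trans ax).
Qed.

Let preitvE b x y : b = (x < a ^+ 2) -> 0 <= y ->
  (fun y : R => y ^+ 2) @^-1` `]x, y] `&` [set h | a <= h] =
  [set` Interval (BSide b (Num.sqrt (Num.max x (a ^+ 2))))
                 (BRight (Num.sqrt y))].
Proof.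
move=> bE y0.
have -> : (fun y : R => y ^+ 2) @^-1` `]x, y] `&` [set h | a <= h] =
    [set h | 0 <= h] `&`
    (fun y : R => y ^+ 2) @^-1` (`]x, y] `&` [set h | a ^+ 2 <= h]).
  apply/seteqP; split => h /=.
    by move=> [? ah]; have h0 := le_trans (ltW a0) ah;
      rewrite ler_sqr ?nnegrE// ltW.
  by move=> [h0 [? ah]]; split => //; rewrite -ler_sqr ?nnegrE// ltW.
rewrite (itvE _ bE).
have p0 : 0 <= Num.max x (a ^+ 2) by rewrite le_max sqr_ge0 orbT.
rewrite -{1}(sqr_sqrtr p0) -{1}(sqr_sqrtr y0).
have q0 := sqrtr_ge0 (Num.max x (a ^+ 2)); have s0 := sqrtr_ge0 y.
apply/seteqP; split => h /=.
  move=> [h0]; rewrite !in_itv /= !ler_sqr ?nnegrE//.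
  by case: b {bE}; rewrite /= ?ler_sqr ?ltr_sqr ?nnegrE.
move=> qhs; have h0 : 0 <= h.
  by move: qhs; rewrite in_itv /= => /andP[/lteifW + _]; exact: le_trans.
move: qhs; rewrite !in_itv /= !ler_sqr ?nnegrE//.
by case: b {bE}; rewrite /= ?ler_sqr ?ltr_sqr ?nnegrE.
Qed.

Let heightsE A : heights A =
  (\int[mu]_(h in A `&` [set h | a ^+ 2 <= h]%R) (G h)%:E)%E.
Proof.
rewrite integral_mkcondr; apply: eq_integral => h _.
rewrite /dens_h patchE indicE.
by case: ifP => _; rewrite ?mulr1 ?mulr0.
Qed.

Let pushedE A : pushed A =
  (\int[mu]_(y in (fun y => y ^+ 2)%R @^-1` A `&` [set y | a <= y]%R)
    (G (y ^+ 2)%R * (2 * y)%R)%:E)%E.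
Proof.
rewrite integral_mkcondr; apply: eq_integral => h _.
rewrite /dens_y patchE indicE.
by case: ifP => _; rewrite ?mulr1 ?mulr0.
Qed.

Let mEG (D : set R) : measurable_fun D (fun h : R => (G h)%:E).
Proof. exact/measurable_EFinP/measurable_funTS. Qed.

Let mEG2 (D : set R) :
  measurable_fun D (fun y : R => (G (y ^+ 2) * (2 * y))%R%:E).
Proof.
apply/measurable_EFinP/measurable_funTS/measurable_funM.
  exact: (measurableT_comp mG msqr).
exact: measurable_funM.
Qed.

Let heights_itv x y : heights `]x, y] =
  (\int[mu]_(h in `[(Num.max x (a ^+ 2))%R, y]) (G h)%:E)%E.
Proof.
rewrite heightsE (itvE y erefl).
have bndoo b :
    (\int[mu]_(h in [set` Interval (BSide b (Num.max x (a ^+ 2))%R)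
                                   (BRight y)]) (G h)%:E =
     \int[mu]_(h in `](Num.max x (a ^+ 2))%R, y[) (G h)%:E)%E.
  by apply: integral_itv_bndoo; exact: mEG.
exact: (etrans (bndoo _) (esym (bndoo true))).
Qed.

Let heights_roots_ocitv A : ocitv A -> heights A = pushed A.
Proof.
move=> [[x y] _ <-] /=; rewrite heights_itv pushedE.
pose p := Num.max x (a ^+ 2); pose q := Num.sqrt p; rewrite -/p.
have p0 : 0 < p by rewrite lt_max exprn_gt0// orbT.
have q0 : 0 < q by rewrite sqrtr_gt0.
have [yp|py] := ltP y p.
  rewrite (_ : `[p, y]%classic = set0); last first.
    apply/seteqP; split => // h /=.
    by rewrite in_itv /= => /andP[/le_trans ph /ph]; rewrite leNgt yp.
  rewrite integral_set0 (_ : _ `&` _ = set0) ?integral_set0//.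
  apply/seteqP; split => // h /= [+ ah]; rewrite in_itv /= => /andP[xh hy].
  have ph : p <= h ^+ 2.
    rewrite ge_max (ltW xh) ler_sqr ?nnegrE// ?(ltW a0)//.
    exact: (le_trans (ltW a0)).
  by have := le_lt_trans (le_trans ph hy) yp; rewrite ltxx.
have y0 : 0 < y := lt_le_trans p0 py.
rewrite (preitvE erefl (ltW y0)) -/p -/q.
have := @integral_sqr_substitution_itv G q (Num.sqrt y) q0 _ cG.
rewrite !sqr_sqrtr ?(ltW y0) ?(ltW p0)// ler_wsqrtr// => /(_ isT) ->.
have bndoo b :
    (\int[mu]_(h in [set` Interval (BSide b q) (BRight (Num.sqrt y))])
       (G (h ^+ 2) * (2 * h))%R%:E =
     \int[mu]_(h in `]q, (Num.sqrt y)%R[) (G (h ^+ 2) * (2 * h))%R%:E)%E.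
  by apply: integral_itv_bndoo; exact: mEG2.
exact: (etrans (bndoo true) (esym (bndoo _))).
Qed.

(** Extension from intervals to Borel sets: half-open intervals are stable under
intersection and generate the Borel sets. *)
Lemma integral_sqr_substitution A : measurable A ->
  (\int[mu]_(h in A) (G h * \1_[set h | a ^+ 2 <= h] h)%R%:E =
   \int[mu]_(y in (fun y => y ^+ 2)%R @^-1` A)
     (G (y ^+ 2) * (2 * y) * \1_[set y | a <= y] y)%R%:E)%E.
Proof.
move=> mA.
rewrite -/(heights A) -/(pushed A).
have mE : @measurable _ (measurableTypeR R) = <<s @ocitv R >> by [].
apply: (@measure_unique _ R (measurableTypeR R) (@ocitv R)
  (fun k : nat => `](- k%:R : R), k%:R]%classic) mE _ _ _ heights pushed) => //.
- exact: ocitvI.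
- by move=> k; exact: is_ocitv.
- exact: (bigcup_itvT false false).
- move=> k; rewrite [X in (X < _)%E](heights_itv (- k%:R) k%:R).
  apply: integrable_lty => //.
  apply: (@continuous_compact_integrable R G); first exact: segment_compact.
  apply: continuous_in_subspaceT => x; rewrite inE /= in_itv /= => /andP[ax _].
  by apply: cG; rewrite (lt_le_trans _ ax)// lt_max exprn_gt0// orbT.
Qed.

End sqr_substitution.
End substitution.

(** * Transport of the Poisson process *)

Section transport.
Variable R : realType.

Lemma counting_image (T U : choiceType) (f : T -> U) (A : set T) :
  {in A &, injective f} -> counting (f @` A) = counting A :> \bar R.
Proof.
move=> fI; have fA : (f @` A #= A)%card := inj_card_eq fI.
rewrite /counting; have [finA|infA] := pselect (finite_set A).
  rewrite !asboolT//; last exact: finite_image.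
  have /finite_setP[n An] := finA.
  by rewrite (card_fset_set An) (card_fset_set (card_eq_trans fA An)).
rewrite !asboolF// => /finite_setP[n fAn]; apply/infA/finite_setP; exists n.
by rewrite -(card_eql fA).
Qed.

(** Jacobian bookkeeping: h^(-(d+1)/2) dh becomes 2 y^(-d) dy for h = y^2. *)
Lemma powR_sqr_mulr (d : nat) (y : R) : 0 < y ->
  (y ^+ 2) `^ (- (d.+1%:R / 2)) * y = y ^- d.
Proof.
move=> y0; rewrite -powR_mulrn ?(ltW y0)// -powRrM.
have -> : 2%:R * - (d.+1%:R / 2) = - d.+1%:R :> R by field.
rewrite powR_invn ?(ltW y0)// exprSr invfM mulfVK//.
by rewrite gt_eqF.
Qed.

Section intensity.
Variable d : nat.
Local Notation point := ('rV[R]_d.-1 * R)%type.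

Definition lift_region (lambda : R) (B : set point) : set point :=
  @square_height R d @^-1` B `&` [set z | lambda <= z.2].

Lemma measurable_lift_region lambda B :
  measurable B -> measurable (lift_region lambda B).
Proof.
move=> mB; apply: measurableI.
  rewrite -[X in measurable X]setTI.
  have : measurable_fun setT (@square_height R d).
    apply/measurable_fun_pairP; split; first exact: measurable_fst.
    exact: (measurable_funX 2 measurable_snd).
  by apply.
rewrite (_ : mkset _ = setT `&` snd @^-1` `[lambda, +oo[).
  exact: (@measurable_snd _ _ 'rV[R]_d.-1 R).
by rewrite setTI; apply/seteqP; split => z /=; rewrite in_itv /= andbT.
Qed.

Lemma point_count_square dO (O : measurableType dO) (lambda : R)
    (eta : O -> set point) : 0 < lambda ->
  forall B,
    point_count
      (fun w => @square_height R d @` truncate_height lambda (eta w)) B =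
    point_count eta (lift_region lambda B).
Proof.
move=> l0 B; apply/funext => w; rewrite /point_count.
rewrite -(@counting_image _ _ (@square_height R d)
  (eta w `&` lift_region lambda B)); last first.
  move=> [v h] [v' h'] /set_mem [_ [_ lh]] /set_mem [_ [_ lh']].
  rewrite /= in lh lh'.
  rewrite /square_height /= => -[-> /eqP].
  by rewrite eqrXn2 ?(le_trans (ltW l0))// => /eqP ->.
congr counting; apply/seteqP; split => z /=.
  by move=> [[x [ex lx] <-] Bx]; exists x.
by move=> [x [ex [Bx lx]] <-]; split => //; exists x.
Qed.

(** Tonelli reduces the identity to the lines {v} x R, where it is the
substitution h = y^2 on the section of [B] over v. *)
Lemma laguerre_intensity_lift gamma lambda : 0 < gamma -> 0 < lambda ->
  forall B, measurable B -> laguerre_intensity gamma lambda B =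
    (gamma%:E * hyp_volume (lift_region lambda B))%E.
Proof.
move=> g0 l0 B mB; pose G h : R := gamma / 2 * h `^ (- (d.+1%:R / 2)).
have mG : measurable_fun setT G.
  by apply: measurable_funM => //; exact: measurable_powR.
have G0 h : 0 <= G h by rewrite mulr_ge0 ?powR_ge0// divr_ge0// ltW.
have cG h : 0 < h -> {for h, continuous G}.
  move=> h0; apply: (@continuousM R R (cst (gamma / 2))).
    exact: cst_continuous.
  apply: differentiable_continuous; apply/derivable1_diffP.
  by apply: derivable_powR; rewrite in_itv /= h0.
have Gsqr y : lambda <= y -> G (y ^+ 2) * (2 * y) = gamma * y ^- d.
  move=> ly; have y0 := lt_le_trans l0 ly.
  by rewrite -(powR_sqr_mulr d y0) /G; field.
have mlt : measurable_fun setT (\1_[set h : R | lambda ^+ 2 <= h] : R -> R).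
  apply: measurable_indic; rewrite (_ : mkset _ = `[lambda ^+ 2, +oo[%classic).
    exact: measurable_itv.
  by apply/seteqP; split => h /=; rewrite in_itv /= andbT.
have mlB := measurable_lift_region lambda mB.
have upB : lift_region lambda B `&` @upper_half R d = lift_region lambda B.
  by apply/setIidl => z [_ /= lz]; exact: (lt_le_trans l0).
have mpow : measurable_fun (lift_region lambda B)
    (fun z : point => (z.2 ^- d)%:E).
  apply/measurable_EFinP.
  apply: (eq_measurable_fun (fun z : point => z.2 `^ (- d%:R))).
    move=> z; rewrite inE => -[_ lz].
    by rewrite powR_invn// (le_trans (ltW l0)).
  apply: measurable_funTS.
  exact: (measurableT_comp (measurable_powR _) measurable_snd).
rewrite /hyp_volume upB -ge0_integralZl//; last 2 first.
- by move=> z [_ lz]; rewrite lee_fin invr_ge0 exprn_ge0// (le_trans (ltW l0)).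
- by rewrite lee_fin ltW.
rewrite /laguerre_intensity [LHS]integral_mkcond [RHS]integral_mkcond.
pose f1 : point -> \bar R :=
  (fun z => (G z.2 * \1_[set h : R | lambda ^+ 2 <= h] z.2)%:E) \_ B.
pose f2 : point -> \bar R :=
  (fun z => gamma%:E * (z.2 ^- d)%:E)%E \_ (lift_region lambda B).
have mf1 : measurable_fun setT f1.
  apply/(measurable_restrictT _ mB)/measurable_EFinP/measurable_funTS.
  apply: measurable_funM; first exact: (measurableT_comp mG measurable_snd).
  exact: (measurableT_comp mlt measurable_snd).
have mf2 : measurable_fun setT f2.
  by apply/(measurable_restrictT _ mlB); exact: measurable_funeM.
have f1_ge0 z : (0 <= f1 z)%E.
  rewrite /f1 patchE; case: ifP => // _.
  by rewrite lee_fin mulr_ge0.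
have f2_ge0 z : (0 <= f2 z)%E.
  rewrite /f2 patchE; case: ifP => // /set_mem[_ lz].
  by rewrite mule_ge0// lee_fin ?ltW// invr_gt0 exprn_gt0// (lt_le_trans l0).
have fub := @fubini_tonelli1 _ _ _ _ R
  (lebesgue_rV R d.-1) (@lebesgue_measure R).
apply: (etrans (fub f1 mf1 f1_ge0)).
apply: (etrans _ (esym (fub f2 mf2 f2_ge0))).
apply: eq_integral => v _; rewrite /fubini_F.
transitivity (\int[@lebesgue_measure R]_(h in xsection B v)
    (G h * \1_[set h | lambda ^+ 2 <= h] h)%R%:E)%E.
  rewrite [RHS]integral_mkcond; apply: eq_integral => h _.
  by rewrite /f1 !patchE mem_xsection.
rewrite (integral_sqr_substitution l0 mG G0 cG); last first.
  exact: measurable_xsection.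
rewrite [LHS]integral_mkcond; apply: eq_integral => y _.
have sec : (y \in (fun y => y ^+ 2) @^-1` xsection B v) =
    (square_height (v, y) \in B).
  by rewrite -[RHS]mem_xsection; apply/idP/idP; rewrite !inE.
rewrite /f2 !patchE indicE sec.
have -> : ((v, y) \in lift_region lambda B) =
    (square_height (v, y) \in B) && (lambda <= y).
  by apply/idP/andP; rewrite !inE => -[].
rewrite (_ : (y \in _) = (lambda <= y)); last by apply/idP/idP; rewrite inE.
case: (_ \in B) => //=; have [ly|_] := leP lambda y; last by rewrite mulr0.
by rewrite mulr1 Gsqr// EFinM.
Qed.

(** The witness is the image of [K], cut at height [lambda ^+ 2], under the
inverse map (v, h) |-> (v, sqrt h), which is continuous. Without the cut this
image could touch the boundary y = 0 of the half-space. *)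
Lemma lift_region_sub_compact K lambda : 0 < lambda -> compact K ->
  exists K' : set point, [/\ compact K', K' `<=` @upper_half R d &
    lift_region lambda K `<=` K'].
Proof.
move=> l0 cK.
exists ((fun z : point => (z.1, Num.sqrt z.2)) @`
  (K `&` [set z | lambda ^+ 2 <= z.2])).
split.
- apply: continuous_compact.
    apply: continuous_subspaceT => z.
    exact: (cvg_pair cvg_fst (continuous_comp cvg_snd (@sqrt_continuous R _))).
  apply: compact_closedI => //.
  apply: (@closed_comp _ _ (fun z : point => z.2) [set x | lambda ^+ 2 <= x]);
    last exact: closed_ge.
  by move=> z _; exact: cvg_snd.
- move=> _ [z [_ /= lz] <-]; rewrite /upper_half /= sqrtr_gt0.
  by rewrite (lt_le_trans _ lz)// exprn_gt0.
- move=> [v h] [Kz /= lh]; have h0 := le_trans (ltW l0) lh.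
  exists (v, h ^+ 2) => /=; last by rewrite sqrtr_sqr ger0_norm.
  by split => //=; rewrite ler_sqr ?nnegrE// ltW.
Qed.

End intensity.
End transport.

Theorem theorem3 (R : realType) (d : nat) (d_ge2 : (2 <= d)%N)
    (dO : measure_display) (O : measurableType dO) (P : probability O R)
    (gamma lambda : R) (gamma_gt0 : 0 < gamma) (lambda_gt0 : 0 < lambda)
    (eta : O -> set ('rV[R]_d.-1 * R)) :
  poisson_process P (@upper_half R d)
    (fun A => gamma%:E * hyp_volume A)%E eta ->
  let eta_lambda := fun w : O => truncate_height lambda (eta w) in
  let eta_tilde := fun w : O => @square_height R d @` eta_lambda w in
  {ae P, forall w : O,
     hyp_delaunay (eta_lambda w) = dual_laguerre (eta_tilde w)} /\
  poisson_process P setT (@laguerre_intensity R d gamma lambda) eta_tilde.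
Proof.
move=> [eta_up eta_fin eta_poisson eta_indep] eta_lambda eta_tilde.
have countE B : point_count eta_tilde B =
    point_count eta (lift_region lambda B).
  exact: (point_count_square _ lambda_gt0).
split.
  apply: aeW => w; apply: hyp_delaunay_square; first exact: ltnW.
  by move=> z [ez _]; exact: (eta_up w).
split => //.
- move=> w K cK _.
  have [K' [cK' K'up KK']] := lift_region_sub_compact lambda_gt0 cK.
  apply: (@sub_finite_set _ _ (@square_height R d @` (eta w `&` K'))).
    move=> _ [[z [ez lz] <-] Kz]; exists z => //; split => //; exact: KK'.
  exact/finite_image/eta_fin.
- move=> B mB; rewrite countE laguerre_intensity_lift//.
  exact: (eta_poisson _ (measurable_lift_region lambda mB)).
- move=> m B mB tB.
  have -> : (fun i => point_count eta_tilde (B i)) =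
      (fun i => point_count eta (lift_region lambda (B i))).
    by apply/funext => i; exact: countE.
  apply: eta_indep => [i|]; first exact: measurable_lift_region.
  move=> i j _ _ [z [[Bi _] [Bj _]]].
  by apply: tB => //; exists (square_height z).
Qed.
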